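(* Let $\Gamma$ be a finitely generated group with a fixed finite symmetric generating set, let $g\in\Gamma$ be a non-central element, and let $C=C_\Gamma(g)$ be the centralizer of $g$ in $\Gamma$. Suppose that for every $\gamma\in\Gamma\setminus C$, $$\lim_{n\to\infty}\frac{\rho(3n)^2\,\alpha_{C\cap\gamma C\gamma^{-1}}(2n)}{\alpha_C(n)}=0 .$$ Then $g$ acts topologically freely on every compact minimal $\Gamma$-space $\mathcal{X}$ with amenable neighborhood stabilizers.
   Context: Let $B_n(\Gamma)$ be the ball of radius $n$ around the identity for the word length of the fixed generating set. Let $\lambda$ be the left regular representation of $\Gamma$ on $\ell^2(\Gamma)$, extended linearly to the group algebra $\mathbb{C}\Gamma$, let $\|\lambda(f)\|$ denote the operator norm, and let $\|f\|_2$ be the $\ell^2$-norm. Define $$\rho(n)=\max\left\{\frac{\|\lambda(f)\|}{\|f\|_2}: 0\neq f\in\mathbb{C}\Gamma,\ \mathrm{supp}(f)\subseteq B_n(\Gamma)\right\}.$$ For a subset $A\subseteq\Gamma$, its growth function is $\alpha_A(n)=|A\cap B_n(\Gamma)|$. A compact $\Gamma$-space is a compact Hausdorff space with an action of $\Gamma$ by homeomorphisms; it is minimal if every orbit is dense. The neighborhood stabilizer of $x\in\mathcal{X}$ is the subgroup $\Gamma_x^o=\{h\in\Gamma: hy=y \text{ for all } y \text{ in some open neighborhood of } x\}$; $\mathcal{X}$ has amenable neighborhood stabilizers if $\Gamma_x^o$ is amenable for all $x\in\mathcal{X}$. An element $g$ acts topologically freely on $\mathcal{X}$ if $\mathrm{Fix}(g)=\{x\in\mathcal{X}: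 gx=x\}$ has empty interior. *)

(* Defs.v *)
(* MathComp / MathComp-Analysis, over an arbitrary [R : realType]. *)
From HB Require Import structures.
From mathcomp Require Import all_boot all_order all_algebra.
From mathcomp Require Import finmap.
From mathcomp Require Import all_classical all_reals all_analysis.
From mathcomp Require Import complex.

Set Implicit Arguments.
Unset Strict Implicit.
Unset Printing Implicit Defensive.

Import Order.TTheory GRing.Theory Num.Theory.
Import numFieldNormedType.Exports.

Local Open Scope classical_set_scope.
Local Open Scope ring_scope.

Definition ball_word (G : groupType) (S : {fset G}) (n : nat) : set G :=
  [set x | exists w : seq G,
    [/\ (size w <= n)%N, {subset w <= S} & x = (\prod_(s <- w) s)%g]].

(* As [S] is closed under inversion, the subgroup it generates is the set of
   values of words in [S]. *)
Definition symmetric_generating (G : groupType) (S : {fset G}) : Prop :=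
  (forall s, s \in S -> (s^-1)%g \in S) /\
  (forall x : G, exists n, ball_word S n x).

Definition growth (G : groupType) (S : {fset G}) (A : set G) (n : nat) : nat :=
  #|` fset_set (A `&` ball_word S n)|%fset.

Definition centralizer (G : groupType) (g : G) : set G :=
  [set h | commute g h].

Definition conj_set (G : groupType) (c : G) (A : set G) : set G :=
  [set (c * a * c^-1)%g | a in A].

Definition sqnorm2 (R : realType) (G : groupType) (xi : G -> R[i]) : \bar R :=
  \esum_(x in [set: G]) (Normc.normc (xi x) ^+ 2)%:E.

Definition ell2 (R : realType) (G : groupType) : set (G -> R[i]) :=
  [set xi | (sqnorm2 xi < +oo)%E].

(* Meaningful on [ell2] only: [fine +oo = 0]. *)
Definition norm2 (R : realType) (G : groupType) (xi : G -> R[i]) : R :=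
  Num.sqrt (fine (sqnorm2 xi)).

Definition left_regular (R : realType) (G : groupType) (y : G)
    (xi : G -> R[i]) : G -> R[i] :=
  fun x => xi (y^-1 * x)%g.

(* An element of the group algebra is a finitely supported [f : G -> R[i]];
   the sum is then over the finite support of its summand. *)
Definition lambda (R : realType) (G : groupType) (f : G -> R[i])
    (xi : G -> R[i]) : G -> R[i] :=
  fun x => \sum_(y \in [set: G]) f y * left_regular y xi x.

(* For finitely supported [f] the set is nonempty and bounded by the l^1-norm of
   [f], so that [sup] is the actual least upper bound. *)
Definition opnorm_lambda (R : realType) (G : groupType) (f : G -> R[i]) : R :=
  sup [set norm2 (lambda f xi) | xi in
         [set xi : G -> R[i] | ell2 xi /\ norm2 xi <= 1]].

(* The set is nonempty, and bounded by the square root of the cardinality of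
   the ball (Cauchy-Schwarz). The supremum is attained by compactness of the
   unit sphere of the functions supported in the ball, hence is a maximum. *)
Definition rho (R : realType) (G : groupType) (S : {fset G}) (n : nat) : R :=
  sup [set opnorm_lambda f / norm2 f | f in
         [set f : G -> R[i] | f <> (fun=> 0) /\
            [set x | f x <> 0] `<=` ball_word S n]].

(* Existence of a left-invariant mean on the bounded real functions on the
   subgroup [H]. These are represented by functions on [G] that are bounded on
   [H]; positivity makes the value of the mean depend on the restriction to [H]
   only. *)
Definition amenable (R : realType) (G : groupType) (H : set G) : Prop :=
  exists m : (G -> R) -> R,
    [/\ m (fun=> 1) = 1,
        forall (a : R) (u v : G -> R),
          [bounded u h | h in H] -> [bounded v h | h in H] ->
          m (fun h => a * u h + v h) = a * m u + m v,
        forall u : G -> R, [bounded u h | h in H] ->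
          (forall h, H h -> 0 <= u h) -> 0 <= m u &
        forall (s : G) (u : G -> R), H s -> [bounded u h | h in H] ->
          m (fun h => u (s * h)%g) = m u].

Definition action_by_homeo (G : groupType) (X : topologicalType)
    (act : G -> X -> X) : Prop :=
  [/\ forall x, act 1%g x = x,
      forall g h x, act (g * h)%g x = act g (act h x) &
      forall g, continuous (act g)].

Definition compact_space (G : groupType) (X : topologicalType)
    (act : G -> X -> X) : Prop :=
  [/\ compact [set: X], hausdorff_space X & action_by_homeo act].

Definition minimal_action (G : groupType) (X : topologicalType)
    (act : G -> X -> X) : Prop :=
  forall x : X, dense [set act g x | g in [set: G]].

Definition nbhs_stabilizer (G : groupType) (X : topologicalType)
    (act : G -> X -> X) (x : X) : set G :=
  [set h | exists2 U : set X, open_nbhs x U & forall y, U y -> act h y = y].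

Definition fixed_points (G : groupType) (X : topologicalType)
    (act : G -> X -> X) (g : G) : set X :=
  [set x | act g x = x].

Definition acts_topologically_freely (G : groupType) (X : topologicalType)
    (act : G -> X -> X) (g : G) : Prop :=
  interior (fixed_points act g) = set0.

(* Main.v *)
Require Import Defs.
From HB Require Import structures.
From mathcomp Require Import all_boot all_order all_algebra.
From mathcomp Require Import finmap.
From mathcomp Require Import all_classical all_reals all_analysis.
From mathcomp Require Import complex.
From mathcomp Require Import lra ring zify.
Import Order.TTheory GRing.Theory Num.Theory.
Import numFieldNormedType.Exports.
Local Open Scope classical_set_scope.
Local Open Scope ring_scope.

Set Implicit Arguments.
Unset Strict Implicit.
Unset Printing Implicit Defensive.

(** Let [U] be the interior of the fixed point set of [g], let [C] be the
    centralizer of [g], and suppose that [U] is not empty.  Conjugating [g] by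
    [w] moves the interior of its fixed points from [U] to [wU]; in particular
    [U] is [C]-invariant, and a conjugate of [g] by [w] lies in the neighborhood
    stabilizer of every point of [wU].

    Fix [k] outside [C] and average over [c] in [C_n = C `&` B_n] the conjugates
    [x_c] of [g] by [c * k].  The (symmetrized) counting function [f] of the
    family [x_c] has l^1-norm [2a] with [a = |C_n|], and its values are at most
    [2b], where [b] is the growth of [C `&` k C k^-1] at [2n], because two
    indices with the same [x_c] differ by an element of that intersection.
    Hence the squared l^2-norm of [f] is at most [4ab].  If [H] is an amenable
    subgroup, the trivial representation of [H] is weakly contained in the
    regular one, so the sum of the nonnegative function [f] over [H] is at most
    the norm of its convolution operator.  As soon as [f] is carried by
    [B_(3n)], this norm is at most [rho(3n) * 2 sqrt(ab)]
    ([count_conj_amenable_le]).  By hypothesis this is [o(a)], uniformly in [H].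
    Applied to the neighborhood stabilizers it says that, uniformly in the point
    [x], only a small proportion of [c] in [C_n] satisfies [x \in ckU].

    By minimality and compactness finitely many translates [kU] cover the space,
    hence so do their translates by any [c] in [C].  A point outside [U] would
    lie, for every [c] in [C_n], in one of the finitely many [ckU] with [k]
    outside [C], against the small proportions.  So [U] is the whole space, and
    then every [c] satisfies [x \in ckU] for any [k] outside [C]: the proportion
    is 1 and not small.

    The inequality on amenable subgroups ([amenable_sum_le_opnorm]) is one half
    of Kesten's theorem.  The proof below goes directly from an invariant mean,
    without almost invariant vectors.  If the operator of convolution by [p] had
    norm less than [F], the sum of [p], a Green function would give [h > 0] with
    [p * h <= r h] for some [r < F].  By Jensen's inequality the weighted sum of
    the functions [w_a : x |-> ln h(a^-1 x) - ln h(x)] is then at most the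
    negative constant [F ln(r/F)].  These functions are bounded, and invariance
    of the mean makes the means of [w_a] and [w_(a^-1)] opposite, so for a
    symmetric [p] the weighted sum has mean 0: a contradiction. *)

(** * Convolution operators on l^2 *)

Lemma sqr_sum_le (R : realFieldType) (T : Type) (s : seq T) (F : T -> R) :
  (\sum_(i <- s) F i) ^+ 2 <= (size s)%:R * \sum_(i <- s) F i ^+ 2.
Proof.
have E (r : seq T) (t : R) : \sum_(i <- r) (F i - t) ^+ 2 =
    \sum_(i <- r) F i ^+ 2 - 2 * t * \sum_(i <- r) F i + (size r)%:R * t ^+ 2.
  elim: r => [|b r IH]; first by rewrite !big_nil /= mulr0 mul0r subrr addr0.
  by rewrite !big_cons IH /= -natr1; ring.
elim: s => [|a s IH]; first by rewrite !big_nil expr0n mul0r.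
have : 0 <= \sum_(i <- s) (F i - F a) ^+ 2.
  by apply: sumr_ge0 => i _; exact: sqr_ge0.
rewrite E !big_cons /= -natr1.
move: IH; set A := F a; set S := \sum_(i <- s) F i.
by set Q := \sum_(i <- s) _; set k := _%:R; nra.
Qed.

Lemma normc_sum_le (R : rcfType) (T : Type) (s : seq T) (F : T -> R[i]) :
  Normc.normc (\sum_(i <- s) F i) <= \sum_(i <- s) Normc.normc (F i).
Proof.
elim: s => [|a s IH]; first by rewrite !big_nil Normc.normc0.
by rewrite !big_cons (le_trans (le_normcD _ _))// lerD2l.
Qed.

Lemma normc_real (R : rcfType) (x : R) : Normc.normc (real_complex R x) = `|x|.
Proof. by rewrite /Normc.normc /= expr0n addr0 sqrtr_sqr. Qed.

Lemma esum_scale_le (R : realType) (T : choiceType) (c : R) (a : T -> R) :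
  0 <= c -> (forall x, 0 <= a x) ->
  (\esum_(x in [set: T]) (c * a x)%:E <=
    c%:E * \esum_(x in [set: T]) (a x)%:E)%E.
Proof.
move=> c0 a0; apply: ge_ereal_sup => _ [X [finX _] <-].
under eq_fsbigr do rewrite EFinM.
rewrite -ge0_mule_fsumr; last by move=> i; rewrite lee_fin.
apply: lee_wpmul2l; first by rewrite lee_fin.
by apply: ereal_sup_ubound; exists X.
Qed.

Lemma sup_ge0 (R : realType) (E : set R) :
  (forall x, E x -> 0 <= x) -> 0 <= sup E.
Proof.
move=> E0; have [hs|/sup_out ->//] := pselect (has_sup E).
have [[x Ex] _] := hs.
exact: le_trans (E0 x Ex) (sup_upper_bound hs Ex).
Qed.

Section ell2.
Variables (R : realType) (G : groupType).
Implicit Types (f xi : G -> R[i]) (y : G).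

Lemma sqnorm2_ge0 xi : (0 <= sqnorm2 xi)%E.
Proof. by apply: esum_ge0 => x _; rewrite lee_fin sqr_ge0. Qed.

Lemma sqnorm2E xi : ell2 xi -> sqnorm2 xi = (norm2 xi ^+ 2)%:E.
Proof.
move=> h; rewrite /norm2 sqr_sqrtr ?fine_ge0 ?sqnorm2_ge0// fineK//.
by rewrite fin_numElt h andbT (lt_le_trans _ (sqnorm2_ge0 xi)).
Qed.

Lemma norm2_ge0 xi : 0 <= norm2 xi.
Proof. exact: sqrtr_ge0. Qed.

Lemma norm2_le xi (c : R) : 0 <= c -> (sqnorm2 xi <= (c ^+ 2)%:E)%E ->
  ell2 xi /\ norm2 xi <= c.
Proof.
move=> c0 h; have he : ell2 xi by rewrite /ell2 /= (le_lt_trans h) ?ltry.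
split=> //; move: h; rewrite sqnorm2E// lee_fin.
by rewrite ler_pXn2r// nnegrE norm2_ge0.
Qed.

Lemma normc_le_norm2 xi y : ell2 xi -> Normc.normc (xi y) <= norm2 xi.
Proof.
move=> h; rewrite -(@ler_pXn2r _ 2)// ?nnegrE ?norm2_ge0//; last first.
  by case: (xi y) => a b; exact: sqrtr_ge0.
rewrite -lee_fin -sqnorm2E//; apply: esum_ge.
exists [set y]; first by split=> //; exact: finite_set1.
by rewrite fsbig_set1.
Qed.

Lemma sqnorm2_left_regular y xi : sqnorm2 (left_regular y xi) = sqnorm2 xi.
Proof.
rewrite /sqnorm2 [RHS](@reindex_esum _ _ _ setT setT (fun x => (y^-1 * x)%g))//.
split=> //; first by move=> a b _ _; exact: mulgI.
by move=> a _; exists (y * a)%g => //; rewrite mulKg.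
Qed.

Lemma sqnorm2_scale_le (c : R) xi :
  (sqnorm2 (fun x => (real_complex R c * xi x)%R) <=
    (c ^+ 2)%:E * sqnorm2 xi)%E.
Proof.
apply: le_trans (esum_scale_le (sqr_ge0 c) (fun x => sqr_ge0 _)).
apply: le_esum => x _.
by rewrite lee_fin Normc.normcM normc_real exprMn real_normK ?num_real.
Qed.

Lemma lambda_fset (A : {fset G}) f xi x : [set z | f z <> 0] `<=` [set` A] ->
  lambda f xi x = \sum_(y <- A) f y * xi (y^-1 * x)%g.
Proof.
move=> fA; rewrite /lambda (@fsbigE _ _ _ _ _ A)//; last first.
  move=> y _ yA; have [->|fy] := pselect (f y = 0); first by rewrite mul0r.
  by have /= := fA y fy; rewrite (negbTE yA).
by apply: eq_bigl => y; rewrite in_setT.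
Qed.

Lemma sqnorm2_fset (A : {fset G}) f : [set z | f z <> 0] `<=` [set` A] ->
  sqnorm2 f = (\sum_(y <- A) Normc.normc (f y) ^+ 2)%:E.
Proof.
move=> fA; rewrite /sqnorm2 -sumEFin fsbig_seq ?fset_uniq//.
rewrite -esum_fset//; last by move=> i _; rewrite lee_fin sqr_ge0.
rewrite [RHS]esum_mkcond; apply: eq_esum => y _.
case: ifPn => //; rewrite notin_setE => yA.
have [->|fy] := pselect (f y = 0); first by rewrite Normc.normc0 expr0n.
by case: yA; exact: fA.
Qed.

(** Cauchy-Schwarz in the finitely many terms of the convolution.  The constant
    depends on [f] only through its l^2-norm and the size of a set carrying it;
    this makes the suprema defining the operator norm and [rho] suprema of
    bounded sets. *)
Lemma sqnorm2_lambda_le (A : {fset G}) f xi :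
  [set z | f z <> 0] `<=` [set` A] -> ell2 xi ->
  (sqnorm2 (lambda f xi) <=
    ((Num.sqrt #|` A|%:R * norm2 f * norm2 xi) ^+ 2)%:E)%E.
Proof.
move=> fA hxi.
have hf : ell2 f by rewrite /ell2 /= (sqnorm2_fset fA) ltry.
rewrite !exprMn sqr_sqrtr// -[_ * norm2 f ^+ 2 * _]mulrA.
rewrite EFinM [X in (_ <= _ * X)%E]EFinM -!sqnorm2E// (sqnorm2_fset fA).
rewrite -sumEFin ge0_sume_distrl; last by move=> i _; rewrite lee_fin sqr_ge0.
have -> : sqnorm2 (lambda f xi) = \esum_(x in [set: G])
   ((Normc.normc (\sum_(y <- A) f y * xi (y^-1 * x)%g)) ^+ 2)%:E.
  by apply: eq_esum => x _; rewrite (lambda_fset _ _ fA).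
apply: (@le_trans _ _ (\esum_(x in [set: G])
    (#|` A|%:R * \sum_(y <- A) Normc.normc (f y * xi (y^-1 * x)%g) ^+ 2)%:E)%E).
  apply: le_esum => x _; rewrite lee_fin.
  apply: le_trans (sqr_sum_le _ _).
  rewrite ler_pXn2r// ?nnegrE ?normc_sum_le//; last first.
    by apply: sumr_ge0 => i _; case: (_ * _) => a b; exact: sqrtr_ge0.
  by case: (\sum_(_ <- _) _) => a b; exact: sqrtr_ge0.
apply: (le_trans (esum_scale_le _ _)) => //.
  by move=> x; apply: sumr_ge0 => y _; exact: sqr_ge0.
apply: lee_wpmul2l; first by rewrite lee_fin.
under eq_esum do rewrite -sumEFin.
rewrite esum_sum; last by move=> *; rewrite lee_fin sqr_ge0.
apply: lee_sum => y _; rewrite -(sqnorm2_left_regular y xi).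
apply: le_trans (esum_scale_le _ _); rewrite ?sqr_ge0// ?(fun x => sqr_ge0)//.
  by apply: le_esum => x _; rewrite lee_fin Normc.normcM exprMn.
by move=> x; exact: sqr_ge0.
Qed.

Lemma norm2_lambda_le_card (A : {fset G}) f xi :
  [set z | f z <> 0] `<=` [set` A] -> ell2 xi ->
  ell2 (lambda f xi) /\
  norm2 (lambda f xi) <= Num.sqrt #|` A|%:R * norm2 f * norm2 xi.
Proof.
move=> fA hxi; apply: norm2_le; last exact: sqnorm2_lambda_le.
by rewrite !mulr_ge0 ?sqrtr_ge0 ?norm2_ge0.
Qed.

Lemma opnorm_lambda_le_card (A : {fset G}) f :
  [set z | f z <> 0] `<=` [set` A] ->
  opnorm_lambda f <= Num.sqrt #|` A|%:R * norm2 f.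
Proof.
move=> fA; apply: ge_sup.
  exists (norm2 (lambda f (fun=> 0))), (fun=> 0) => //.
  have [] := @norm2_le (fun=> 0) 0 => //.
    by rewrite expr0n /sqnorm2 esum1// => x _; rewrite Normc.normc0 expr0n.
  by move=> h1 h2; split=> //; rewrite (le_trans h2).
move=> _ [xi [hxi xi1] <-]; have [_] := norm2_lambda_le_card fA hxi.
move/le_trans; apply; apply: ler_piMr => //.
by rewrite mulr_ge0 ?sqrtr_ge0 ?norm2_ge0.
Qed.

Lemma norm2_lambda_le_opnorm (A : {fset G}) f xi :
  [set z | f z <> 0] `<=` [set` A] -> ell2 xi ->
  norm2 (lambda f xi) <= opnorm_lambda f * norm2 xi.
Proof.
move=> fA hxi; have [_ hb] := norm2_lambda_le_card fA hxi.
have [N0|N0] := eqVneq (norm2 xi) 0.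
  by move: hb; rewrite N0 !mulr0.
have Ngt0 : 0 < norm2 xi by rewrite lt_neqAle eq_sym N0 norm2_ge0.
pose eta := fun x => real_complex R (norm2 xi)^-1 * xi x.
have [heta eta1] : ell2 eta /\ norm2 eta <= 1.
  apply: norm2_le => //; apply: (le_trans (sqnorm2_scale_le _ _)).
  by rewrite sqnorm2E// -EFinM -exprMn mulVf.
have [he _] := norm2_lambda_le_card fA heta.
have le1 : norm2 (lambda f eta) <= opnorm_lambda f.
  apply: sup_upper_bound; last by exists eta.
  split; first by exists (norm2 (lambda f eta)), eta.
  exists (Num.sqrt #|` A|%:R * norm2 f) => _ [z [hz z1] <-].
  have [_] := norm2_lambda_le_card fA hz.
  move/le_trans; apply; apply: ler_piMr => //.
  by rewrite mulr_ge0 ?sqrtr_ge0 ?norm2_ge0.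
have -> : lambda f xi = fun x => real_complex R (norm2 xi) * lambda f eta x.
  apply: funext => x; rewrite !(lambda_fset _ _ fA) mulr_sumr.
  apply: eq_bigr => y _; rewrite /eta mulrCA [X in _ = _ * X]mulrA.
  by rewrite -[X in _ = _ * (X * _)]rmorphM mulfV// rmorph1 mul1r.
apply: (@le_trans _ _ (norm2 xi * norm2 (lambda f eta))).
  apply: (norm2_le _ _).2; first by rewrite mulr_ge0 ?norm2_ge0.
  by rewrite exprMn EFinM -(sqnorm2E he); exact: sqnorm2_scale_le.
by rewrite mulrC ler_wpM2r ?norm2_ge0.
Qed.

End ell2.

(** * Means and positive superharmonic functions *)

Lemma bounded_onP (R : realType) (T : Type) (D : set T) (u : T -> R) (M : R) :
  (forall x, D x -> `|u x| <= M) -> [bounded u x | x in D].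
Proof.
move=> h; exists M; split; first exact: num_real.
by move=> N MN x Dx /=; rewrite (le_trans (h _ Dx))// ltW.
Qed.

Lemma sum_odd_eq0 (R : realType) (G : groupType) (A : {fset G}) (M : G -> R) :
  (forall a, a \notin A -> M a = 0) -> (forall a, M a^-1%g = - M a) ->
  \sum_(a <- A) M a = 0.
Proof.
move=> M0 Modd.
have E (N : G -> R) : (forall a, a \notin A -> N a = 0) ->
    \sum_(a \in [set: G]) N a = \sum_(a <- A) N a.
  move=> N0; rewrite (@fsbigE _ _ _ _ _ A)//; last by move=> a _; exact: N0.
  by apply: eq_bigl => a; rewrite in_setT.
have : \sum_(a \in [set: G]) M a = - \sum_(a <- A) M a.
  rewrite (@reindex_fsbigT _ _ _ _ _ (fun a => a^-1)%g); last first.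
    by exists (fun a => a^-1)%g => a; rewrite invgK.
  under eq_fsbigr do rewrite Modd.
  by rewrite E ?sumrN// => a /M0 ->; rewrite oppr0.
by rewrite E//; lra.
Qed.

(** A mean is only assumed to be linear on functions bounded on [H], which is
    why the lemmas of this section carry explicit bounds. *)
Section mean.
Variables (R : realType) (G : groupType) (H : set G) (m : (G -> R) -> R).
Hypothesis m_linear : forall (a : R) (u v : G -> R),
  [bounded u h | h in H] -> [bounded v h | h in H] ->
  m (fun h => a * u h + v h) = a * m u + m v.

Lemma mean0 : m (fun=> 0) = 0.
Proof.
have b0 : [bounded (0 : R) | h in H].
  by apply: (@bounded_onP _ _ _ _ 0) => h _; rewrite normr0.
have := m_linear 1 b0 b0.
rewrite (_ : (fun _ => _) = (fun=> 0)); first by lra.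
by apply: funext => h; rewrite mulr0 addr0.
Qed.

Lemma mean_scale (a : R) (u : G -> R) (M : R) :
  (forall x, H x -> `|u x| <= M) -> m (fun h => a * u h) = a * m u.
Proof.
move=> /bounded_onP bu.
have b0 : [bounded (0 : R) | h in H].
  by apply: (@bounded_onP _ _ _ _ 0) => h _; rewrite normr0.
have := m_linear a bu b0; rewrite mean0 addr0 => <-.
by congr m; apply: funext => h; rewrite addr0.
Qed.

Lemma mean_sum (T : Type) (s : seq T) (u : T -> G -> R) (B : T -> R) :
  (forall i x, H x -> `|u i x| <= B i) ->
  m (fun x => \sum_(i <- s) u i x) = \sum_(i <- s) m (u i).
Proof.
move=> bu; elim: s => [|i s IH].
  rewrite big_nil -[RHS]mean0; congr m; apply: funext => h.
  by rewrite big_nil.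
have bs : [bounded \sum_(j <- s) u j x | x in H].
  apply: (@bounded_onP _ _ _ _ (\sum_(j <- s) B j)) => x Hx.
  by rewrite (le_trans (ler_norm_sum _ _ _))// ler_sum// => j _; exact: bu.
rewrite big_cons -IH -[X in X + _]mul1r -(m_linear 1 (bounded_onP (bu i)) bs).
by congr m; apply: funext => h; rewrite big_cons mul1r.
Qed.
End mean.

Lemma ln_le_subr1 (R : realType) (x : R) : 0 < x -> ln x <= x - 1.
Proof.
move=> x0; have := @le_ln1Dx R (x - 1); rewrite subrKC; apply; lra.
Qed.

(** On an amenable group a positive function cannot be contracted by a symmetric
    averaging operator.  The logarithmic increments [w a] are bounded because
    [h] satisfies a Harnack inequality; their means are odd in [a], whereas
    concavity of the logarithm bounds their sum by a negative constant if
    [r < \sum p a]. *)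
Lemma amenable_supharmonic_sum_le (R : realType) (G : groupType) (H : set G)
    (A : {fset G}) (p h : G -> R) (r : R) :
  amenable R H ->
  (forall x, 0 <= p x) -> (forall x, p x^-1%g = p x) ->
  (forall x, p x <> 0 -> H x /\ x \in A) ->
  (forall x, 0 < h x) ->
  (forall x, \sum_(a <- A) p a * h (a^-1 * x)%g <= r * h x) ->
  \sum_(a <- A) p a <= r.
Proof.
move=> [m [m1 mlin mpos minv]] p0 psym pH h0 hr.
set F := \sum_(a <- A) p a; rewrite leNgt; apply/negP => rF.
(* [hr] forces [r >= 0]; the midpoint of [r] and [F] is then positive. *)
wlog r0 : r hr rF / 0 < r => [wl|].
  have r0 : 0 <= r.
    have : 0 <= r * h 1%g.
      apply: le_trans (hr _); apply: sumr_ge0 => a _.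
      by rewrite mulr_ge0// ltW.
    by rewrite pmulr_lge0.
  apply: (wl ((r + F) / 2)); [|lra|lra].
  by move=> x; apply: (le_trans (hr x)); rewrite ler_pM2r//; lra.
have F0 : 0 < F by exact: lt_trans rF.
(* One term of the sum in [hr] is bounded by the whole sum. *)
have harnack a x : p a != 0 -> h (a^-1 * x)%g <= r / p a * h x.
  move=> pa; have pa0 : 0 < p a by rewrite lt_neqAle eq_sym pa p0.
  rewrite mulrAC ler_pdivlMr// mulrC; apply: le_trans (hr x).
  have [_ aA] := pH a (elimN eqP pa).
  rewrite (big_fsetD1 a)//= lerDl; apply: sumr_ge0 => b _.
  by rewrite mulr_ge0// ltW.
(* The factor [p a] makes [w a] bounded, namely 0, when [p a] vanishes. *)
pose w a x : R := p a * (ln (h (a^-1 * x)%g) - ln (h x)).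
have wb a x : `|w a x| <= p a * ln (r / p a).
  have [pa|pa] := eqVneq (p a) 0; first by rewrite /w pa !mul0r normr0.
  have pa0 : 0 < p a by rewrite lt_neqAle eq_sym pa p0.
  rewrite /w normrM ger0_norm// ler_pM2l// ler_norml.
  have c0 : 0 < r / p a by rewrite divr_gt0.
  have h1 : ln (h (a^-1 * x)%g) <= ln (r / p a) + ln (h x).
    rewrite -lnM ?posrE// ler_ln ?posrE ?(mulr_gt0 c0)//; exact: harnack.
  have h2 : ln (h x) <= ln (r / p a) + ln (h (a^-1 * x)%g).
    rewrite -lnM ?posrE// ler_ln ?posrE ?(mulr_gt0 c0)//.
    have := @harnack a^-1%g (a^-1 * x)%g; by rewrite psym invgK mulVKg => ->.
  by apply/andP; split; lra.
(* Translating [w a^-1] by [a^-1] gives [- w a]. *)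
have mw a : m (w a^-1%g) = - m (w a).
  have [pa|pa] := eqVneq (p a) 0.
    have w0 b : p b = 0 -> w b = fun=> 0.
      by move=> pb; apply: funext => x; rewrite /w pb mul0r.
    by rewrite !w0 ?psym// (mean0 mlin) oppr0.
  have [Ha _] := pH a (elimN eqP pa).
  have [Ha' _] : H a^-1%g /\ a^-1%g \in A by apply: pH; rewrite psym; exact/eqP.
  rewrite -(@minv a^-1%g)//; last by apply: bounded_onP => x _; exact: wb.
  rewrite -mulN1r -(@mean_scale _ _ _ _ mlin _ _ (p a * ln (r / p a)))//.
  congr m; apply: funext => x.
  by rewrite /w invgK mulVKg psym; ring.
have sum0 : \sum_(a <- A) m (w a) = 0.
  apply: sum_odd_eq0 => // a aA.
  have -> : w a = fun=> 0.
    apply: funext => x; rewrite /w; have [->|pa] := eqVneq (p a) 0.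
      by rewrite mul0r.
    by have [_] := pH a (elimN eqP pa); rewrite (negbTE aA).
  exact: mean0 mlin.
have wsum x : \sum_(a <- A) w a x <= F * ln (r / F).
  have rF0 : 0 < r / F by rewrite divr_gt0.
  (* The tangent line of the logarithm at [r / F], the average of the ratios
     [h (a^-1 * x) / h x] in the extreme case, stands in for Jensen. *)
  have lnle y : 0 < y -> ln y <= y / (r / F) - 1 + ln (r / F).
    move=> y0; have -> : ln y = ln (y / (r / F)) + ln (r / F).
      by rewrite -lnM ?posrE ?divr_gt0// divfK// gt_eqF.
    rewrite lerD2r; have : 0 < y / (r / F) by exact: divr_gt0.
    by move=> /ln_le_subr1.
  apply: (@le_trans _ _ (\sum_(a <- A)
     (p a * h (a^-1 * x)%g * (h x * (r / F))^-1 + p a * (ln (r / F) - 1)))).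
    apply: ler_sum => a _; rewrite /w -mulrA -mulrDr ler_wpM2l//.
    rewrite -ln_div ?posrE//; apply: (le_trans (lnle _ _)).
      by rewrite divr_gt0.
    by rewrite invfM mulrA; lra.
  rewrite big_split /= -!mulr_suml -/F.
  have : (\sum_(a <- A) p a * h (a^-1 * x)%g) / (h x * (r / F)) <= F.
    rewrite ler_pdivrMr ?(mulr_gt0 (h0 x) rF0)//; apply: (le_trans (hr x)).
    by rewrite mulrCA [_ * (r / F)]mulrC divfK ?gt_eqF// mulrC.
  by rewrite mulrBr mulr1; lra.
have lnneg : ln (r / F) < 0 by rewrite ln_lt0// divr_gt0//= ltr_pdivrMr// mul1r.
pose c := - (F * ln (r / F)).
have c0 : 0 < c by rewrite /c oppr_gt0 pmulr_rlt0.
have bc : [bounded - c | x in H].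
  by apply: (@bounded_onP _ _ _ _ `|- c|) => x _.
have bw : [bounded \sum_(a <- A) w a x | x in H].
  apply: (@bounded_onP _ _ _ _ (\sum_(a <- A) p a * ln (r / p a))) => x _.
  by rewrite (le_trans (ler_norm_sum _ _ _))// ler_sum// => a _; exact: wb.
(* The function below is nonnegative but has mean [- c < 0]. *)
have : 0 <= m (fun x => -1 * (\sum_(a <- A) w a x) + - c).
  apply: mpos => [|x _]; last by have := wsum x; rewrite /c; lra.
  apply: (@bounded_onP _ _ _ _ (\sum_(a <- A) p a * ln (r / p a) + c)) => x _.
  rewrite mulN1r (le_trans (ler_normB _ _))// normrN lerD ?(gtr0_norm c0)//.
  by rewrite (le_trans (ler_norm_sum _ _ _))// ler_sum// => a _; exact: wb.
have -> : m (fun x => -1 * (\sum_(a <- A) w a x) + - c) = - c.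
  rewrite mlin// (mean_sum mlin _ (fun a x _ => wb a x)) sum0 mulr0 add0r.
  have := @mean_scale _ _ _ _ mlin (- c) (fun=> 1) 1.
  rewrite m1 mulr1 => E; rewrite -[RHS]E; last by move=> *; rewrite normr1.
  by congr m; apply: funext => ?; rewrite mulr1.
by rewrite oppr_ge0 leNgt c0.
Qed.

(** * Green functions and the norm bound for amenable subgroups *)

Section walk.
Variables (R : realType) (G : groupType) (A : {fset G}) (p : G -> R).
Hypothesis p0 : forall x, 0 <= p x.

(** [walk n] is the [n]-th convolution power of [p] cut off outside [A]. *)
Fixpoint walk (n : nat) (x : G) : R :=
  if n is k.+1 then \sum_(a <- A) p a * walk k (a^-1 * x)%g
  else (x == 1%g)%:R.

Lemma walk_ge0 n x : 0 <= walk n x.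
Proof.
elim: n x => [|n IH] x /=; first by rewrite ler0n.
by apply: sumr_ge0 => a _; rewrite mulr_ge0.
Qed.

Lemma walk_step n a x : a \in A -> 0 < p a -> 0 < walk n x ->
  0 < walk n.+1 (a * x)%g.
Proof.
move=> aA pa wx; rewrite /= (big_fsetD1 a)//= mulKg ltr_wpDr ?mulr_gt0//.
by apply: sumr_ge0 => b _; rewrite mulr_ge0// walk_ge0.
Qed.

Definition green (r : R) (x : G) : R :=
  limn (series (fun n => walk n x / r ^+ n)).

Section green.
Variables (L r : R).
Hypotheses (L0 : 0 <= L) (Lr : L < r) (walkL : forall n x, walk n x <= L ^+ n).

Let r0 : 0 < r. Proof. exact: le_lt_trans Lr. Qed.

Let term_ge0 x n : 0 <= walk n x / r ^+ n.
Proof. by rewrite divr_ge0 ?walk_ge0// exprn_ge0// ltW. Qed.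

Let green_cvg x : cvgn (series (fun n => walk n x / r ^+ n)).
Proof.
apply: (@series_le_cvg _ _ (geometric 1 (L / r))).
- exact: term_ge0.
- by move=> n; rewrite /geometric /= mul1r exprn_ge0// divr_ge0// ltW.
- move=> n; rewrite /geometric /= mul1r expr_div_n ler_pM2r ?walkL//.
  by rewrite invr_gt0 exprn_gt0.
- apply: is_cvg_geometric_series; rewrite ger0_norm ?divr_ge0// ?(ltW r0)//.
  by rewrite ltr_pdivrMr// mul1r.
Qed.

Let series_le_green x N : series (fun n => walk n x / r ^+ n) N <= green r x.
Proof.
by apply: nondecreasing_cvgn_le => //; apply: nondecreasing_series => n _ _.
Qed.

Lemma green_gt0 n x : 0 < walk n x -> 0 < green r x.
Proof.
move=> wx; apply: lt_le_trans (series_le_green x n.+1).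
rewrite seriesSr ltr_wpDl ?divr_gt0 ?exprn_gt0//.
by rewrite /series /= sumr_ge0.
Qed.

(** Convolving with [p] shifts the series of the Green function by one term. *)
Lemma green_supharmonic x :
  \sum_(a <- A) p a * green r (a^-1 * x)%g <= r * green r x.
Proof.
have : (fun N => \sum_(a <- A) p a *
     series (fun n => walk n (a^-1 * x)%g / r ^+ n) N) @ \oo -->
     \sum_(a <- A) p a * green r (a^-1 * x)%g.
  apply: cvg_big => //; first exact: add_continuous.
  by move=> a _; apply: cvgMl_tmp; exact: green_cvg.
move/cvgr_to_le; apply; apply: nearW => N.
apply: le_trans (ler_wpM2l (ltW r0) (series_le_green x N.+1)).
rewrite /series /= big_nat_recl// mulrDr.
have -> : \sum_(a <- A) p a * \sum_(0 <= n < N) walk n (a^-1 * x)%g / r ^+ n =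
    r * \sum_(0 <= n < N) walk n.+1 x / r ^+ n.+1.
  under eq_bigr do rewrite mulr_sumr; rewrite exchange_big mulr_sumr /=.
  apply: eq_bigr => n _; rewrite exprS invfM mulrCA mulVKf ?gt_eqF//.
  by rewrite mulr_suml; apply: eq_bigr => a _; rewrite mulrA.
by rewrite lerDr mulr_ge0 ?(ltW r0)//; exact: term_ge0 x 0.
Qed.
End green.

Section coset.
Hypotheses (psym : forall x, p x^-1%g = p x)
  (pA : forall x, p x <> 0 -> x \in A).

(** The Green function is positive only on the subgroup generated by the support
    of [p].  Translating it by representatives of the right cosets of this
    subgroup makes it positive everywhere; convolution by [p] on the left does
    not leave a coset.  The coset of [x] is described as the set of all [y] for
    which some power of [p] charges [x * y^-1]. *)
Let rep (x : G) : G := xget 1%g [set y | exists n, 0 < walk n (x * y^-1)%g].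

Let rep_reachable x : exists n, 0 < walk n (x * (rep x)^-1)%g.
Proof.
rewrite /rep; case: xgetP => // /(_ x) []; exists 0%N.
by rewrite mulgV /= eqxx.
Qed.

Let rep_step a x : p a != 0 -> rep (a^-1 * x)%g = rep x.
Proof.
move=> pa; have pa0 : 0 < p a by rewrite lt_neqAle eq_sym pa p0.
rewrite /rep; congr xget; apply/seteqP; split=> y [n] wn; exists n.+1.
  have := walk_step (pA (elimN eqP pa)) pa0 wn.
  by rewrite -mulgA mulVKg.
rewrite -mulgA; apply: walk_step => //; last by rewrite psym.
by apply: pA; rewrite psym; exact/eqP.
Qed.

Lemma exists_supharmonic (L r : R) : 0 <= L -> L < r ->
  (forall n x, walk n x <= L ^+ n) ->
  exists h : G -> R, (forall x, 0 < h x) /\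
    forall x, \sum_(a <- A) p a * h (a^-1 * x)%g <= r * h x.
Proof.
move=> L0 Lr wL; exists (fun x => green r (x * (rep x)^-1)%g); split=> x.
  by have [n /(green_gt0 L0 Lr wL)] := rep_reachable x.
apply: le_trans (green_supharmonic L0 Lr wL _).
rewrite le_eqVlt; apply/orP; left; apply/eqP; apply: eq_bigr => a _.
have [->|pa] := eqVneq (p a) 0; first by rewrite !mul0r.
by rewrite rep_step// mulgA.
Qed.
End coset.
End walk.

(** One half of Kesten's theorem.  Restricting [f] to [H] does not increase the
    l^2-norms of the convolution powers, since all functions involved are
    nonnegative; these powers are therefore at most the powers of the operator
    norm, and the Green function converges as soon as [r] exceeds this norm. *)
Theorem amenable_sum_le_opnorm (R : realType) (G : groupType) (H : set G)
    (A : {fset G}) (f : G -> R) :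
  amenable R H -> (forall x, H x -> H x^-1%g) ->
  (forall x, 0 <= f x) -> (forall x, f x^-1%g = f x) ->
  [set x | f x <> 0] `<=` [set` A] ->
  \sum_(a <- A | a \in H) f a <= opnorm_lambda (fun x => real_complex R (f x)).
Proof.
move=> amH HV f0 fsym fA.
pose fc x := real_complex R (f x); rewrite -/fc.
have fcA : [set x | fc x <> 0] `<=` [set` A].
  by move=> x fx; apply: fA => /= fx0; apply: fx; rewrite /fc fx0.
set L := opnorm_lambda fc.
pose p x := if x \in H then f x else 0.
have p0 x : 0 <= p x by rewrite /p; case: ifP.
have pf x : p x <= f x by rewrite /p; case: ifP.
have HVE x : (x^-1%g \in H) = (x \in H).
  apply/idP/idP; rewrite !inE; last exact: HV.
  by move=> /HV; rewrite invgK.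
have psym x : p x^-1%g = p x by rewrite /p HVE fsym.
have pHA x : p x <> 0 -> H x /\ x \in A.
  rewrite /p; case: ifPn => // /set_mem Hx fx; split=> //.
  exact: fA.
rewrite big_mkcond /=; rewrite -[leLHS]/(\sum_(a <- A) p a).
have L0 : 0 <= L by apply: sup_ge0 => _ [xi _ <-]; exact: norm2_ge0.
pose w n x := real_complex R (walk A p n x).
have w_ell2 n : ell2 (w n) /\ norm2 (w n) <= L ^+ n.
  have [w0 w1] : ell2 (w 0%N) /\ norm2 (w 0%N) <= 1.
    apply: norm2_le => //; rewrite (@sqnorm2_fset _ _ [fset 1%g]%fset).
      by rewrite big_seq_fset1 /w normc_real /= eqxx normr1.
    move=> x wx; rewrite /= inE; apply: contra_notT wx => /negbTE x1.
    by rewrite /w [walk _ _ _ _]/= x1 rmorph0.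
  elim: n => [|n [we wn]]; first by [].
  have [le _] := norm2_lambda_le_card fcA we.
  have hL := norm2_lambda_le_opnorm fcA we.
  have [we' wn'] : ell2 (w n.+1) /\ norm2 (w n.+1) <= norm2 (lambda fc (w n)).
    apply: norm2_le; first exact: norm2_ge0.
    rewrite -(sqnorm2E le); apply: le_esum => x _; rewrite lee_fin.
    rewrite (lambda_fset _ _ fcA).
    have -> : \sum_(y <- A) fc y * w n (y^-1 * x)%g =
        real_complex R (\sum_(y <- A) f y * walk A p n (y^-1 * x)%g).
      by rewrite rmorph_sum; apply: eq_bigr => y _; rewrite rmorphM.
    have le_sum : walk A p n.+1 x <=
        \sum_(y <- A) f y * walk A p n (y^-1 * x)%g.
      by apply: ler_sum => y _; rewrite ler_wpM2r// walk_ge0.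
    have ge0 := walk_ge0 A p0 n.+1 x.
    rewrite !normc_real !ger0_norm ?(le_trans ge0)//.
    by rewrite ler_pXn2r// nnegrE// (le_trans ge0).
  split=> //; apply: (le_trans wn'); apply: (le_trans hL).
  by rewrite exprS ler_wpM2l.
have wL n x : walk A p n x <= L ^+ n.
  have [we wn] := w_ell2 n; apply: le_trans wn.
  apply: le_trans (normc_le_norm2 x we).
  by rewrite normc_real ler_norm.
rewrite leNgt; apply/negP; set F := \sum_(a <- A) p a => LF.
have Lr : L < (L + F) / 2 by lra.
have [h [h0 hr]] :=
  exists_supharmonic p0 psym (fun x px => (pHA x px).2) L0 Lr wL.
have := amenable_supharmonic_sum_le amH p0 psym pHA h0 hr.
by rewrite -/F; lra.
Qed.

(** * Word balls and the growth of operator norms *)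

Section ball.
Variables (G : groupType) (S : {fset G}).

Lemma ball_word_le m n : (m <= n)%N -> ball_word S m `<=` ball_word S n.
Proof.
by move=> mn x [w [wm wS xw]]; exists w; split=> //; exact: leq_trans mn.
Qed.

Lemma ball_word1 n : ball_word S n 1%g.
Proof. by exists [::]; split=> //; rewrite big_nil. Qed.

Lemma ball_wordM m n x y : ball_word S m x -> ball_word S n y ->
  ball_word S (m + n) (x * y)%g.
Proof.
move=> [v [vm vS ->]] [w [wn wS ->]]; exists (v ++ w); split.
- by rewrite size_cat leq_add.
- by move=> s; rewrite mem_cat => /orP[/vS|/wS].
- by rewrite big_cat.
Qed.

Lemma ball_wordV n x : symmetric_generating S ->
  ball_word S n x -> ball_word S n x^-1%g.
Proof.
move=> [SV _] [w [wn wS ->]]; exists (rev [seq s^-1%g | s <- w]); split.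
- by rewrite size_rev size_map.
- by move=> s; rewrite mem_rev => /mapP[t /wS /SV ? ->].
- elim: w {wn wS} => [|s w IH]; first by rewrite !big_nil invg1.
  by rewrite /= rev_cons big_rcons big_cons invgM IH.
Qed.

Lemma finite_ball_word n : finite_set (ball_word S n).
Proof.
elim: n => [|n IH].
  apply: (@sub_finite_set _ _ [set 1%g]) => // x [[|s w] [] // _ _ ->].
  by rewrite big_nil.
apply: (@sub_finite_set _ _ (ball_word S n `|`
    (fun p : G * G => p.1 * p.2)%g @` ([set` S] `*` ball_word S n))).
  move=> x [[|s w] [wn wS ->]].
    by left; rewrite big_nil; exact: ball_word1.
  right; exists (s, (\prod_(t <- w) t)%g); last by rewrite big_cons.
  split=> /=; first by apply: wS; rewrite mem_head.
  by exists w; split=> // t tw; apply: wS; rewrite inE tw orbT.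
rewrite finite_setU; split=> //; apply: finite_image.
by apply: finite_setX.
Qed.

Lemma in_ball (A : set G) n x :
  (x \in fset_set (A `&` ball_word S n)) = (x \in A `&` ball_word S n).
Proof.
by rewrite in_fset_set//; apply: finite_setIr; exact: finite_ball_word.
Qed.
End ball.

Lemma opnorm_lambda_le_rho (R : realType) (G : groupType) (S : {fset G}) n
    (f : G -> R[i]) : [set x | f x <> 0] `<=` ball_word S n ->
  opnorm_lambda f <= rho R S n * norm2 f.
Proof.
move=> fB.
pose A := fset_set (ball_word S n).
have AE (h : G -> R[i]) : [set x | h x <> 0] `<=` ball_word S n ->
    [set x | h x <> 0] `<=` [set` A].
  by move=> hB x /hB hx; rewrite /= in_fset_set ?inE//; exact: finite_ball_word.
have [f0|fN0] := pselect (f = fun=> 0).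
  have := opnorm_lambda_le_card (AE _ fB).
  suff -> : norm2 f = 0 by rewrite !mulr0.
  apply/eqP; rewrite eq_le norm2_ge0 andbT; apply: (norm2_le _ _).2 => //.
  by rewrite /sqnorm2 esum1 ?expr0n// => x _; rewrite f0 Normc.normc0 expr0n.
have n0 (h : G -> R[i]) : [set x | h x <> 0] `<=` ball_word S n ->
    h <> (fun=> 0) -> 0 < norm2 h.
  move=> hB hN0; rewrite lt_neqAle norm2_ge0 andbT eq_sym; apply/eqP => h0.
  apply: hN0; apply: funext => x; apply: Normc.eq0_normc; apply/eqP.
  rewrite eq_le -{1}h0 normc_le_norm2 /=.
    by case: (h x) => a b; exact: sqrtr_ge0.
  by rewrite /ell2 /= (sqnorm2_fset (AE _ hB)) ltry.
rewrite -ler_pdivrMr ?n0//; apply: sup_upper_bound; last by exists f.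
split; first by exists (opnorm_lambda f / norm2 f), f.
exists (Num.sqrt #|` A|%:R) => _ [h [hN0 hB] <-].
by rewrite ler_pdivrMr ?n0//; exact: opnorm_lambda_le_card (AE _ hB).
Qed.

(** * Conjugates of an element by a ball of its centralizer *)

Lemma sumr_pred_count (R : pzSemiRingType) (T : Type) (s : seq T) (P : pred T) :
  \sum_(c <- s) (P c)%:R = (count P s)%:R :> R.
Proof.
rewrite -sum1_count natr_sum [RHS]big_mkcond /=.
by apply: eq_bigr => c _; case: (P c).
Qed.

Section counting.
Variables (R : realType) (G : groupType) (S : {fset G}).
Hypothesis hS : symmetric_generating S.
Variables (g k : G) (n : nat).
Let C := centralizer g.
Let D := fset_set (C `&` ball_word S n).
Let x (c : G) : G := (c * (k * g * k^-1) * c^-1)%g.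

(** If [x c0 = x c], then [c0^-1 * c] commutes with [g] and with
    [k * g * k^-1]; so a fiber of [x] injects, by left translation, into the
    intersection of the two centralizers. *)
Lemma count_conj_fiber_le (z : G) :
  (count (fun c => x c == z) D <= growth S (C `&` conj_set k C) (2 * n))%N.
Proof.
rewrite -size_filter; set F := seq.filter _ _.
have [->//|c0] : F = [::] \/ exists c0, c0 \in F.
  by case: (F) => [|c s]; [left|right; exists c; rewrite mem_head].
move: c0 => [c0 c0F].
rewrite -(size_map (fun c => c0^-1 * c)%g); apply: uniq_leq_size.
  by rewrite map_inj_uniq ?filter_uniq ?fset_uniq//; exact: mulgI.
move=> _ /mapP[c cF ->]; rewrite in_ball; apply/mem_set.
move: c0F cF; rewrite !mem_filter !in_ball => /andP[/eqP xc0 /set_mem[Cc0 Bc0]].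
move=> /andP[/eqP xc /set_mem[Cc Bc]].
have Cd : C (c0^-1 * c)%g.
  by apply: commuteM => //; exact: commuteV.
split; last by rewrite mul2n -addnn; apply: ball_wordM => //; exact: ball_wordV.
split=> //; exists (k^-1 * (c0^-1 * c) * k)%g; last first.
  by rewrite !mulgA mulgV mul1g mulgK.
move: xc; rewrite -xc0 /x /C /centralizer /= /commute => E.
have -> : (k^-1 * (c0^-1 * c) * k * g = k^-1 * c0^-1 *
    (c * (k * g * k^-1) * c^-1) * (c * k))%g by rewrite !mulgA !mulgVK.
by rewrite E !mulgA !mulgVK mulVg mul1g.
Qed.

(** Adding the inverses makes the counting function of [x] symmetric, as
    [amenable_sum_le_opnorm] requires. *)
Definition conj_sum (z : G) : R :=
  \sum_(c <- D) ((x c == z)%:R + ((x c)^-1%g == z)%:R).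

Lemma conj_sum_ge0 z : 0 <= conj_sum z.
Proof. by apply: sumr_ge0 => c _; rewrite addr_ge0. Qed.

Lemma conj_sumV z : conj_sum z^-1%g = conj_sum z.
Proof.
apply: eq_bigr => c _.
rewrite addrC (inj_eq invg_inj); congr (_ + (nat_of_bool _)%:R).
by rewrite -[RHS](inj_eq invg_inj) invgK.
Qed.

Lemma conj_sum_le z :
  conj_sum z <= 2 * (growth S (C `&` conj_set k C) (2 * n))%:R.
Proof.
rewrite /conj_sum big_split /= !sumr_pred_count.
have -> : count (fun c => (x c)^-1%g == z) D = count (fun c => x c == z^-1%g) D.
  by apply: eq_count => c /=; rewrite -(inj_eq invg_inj) invgK.
by rewrite -natrD -natrM ler_nat mul2n -addnn leq_add ?count_conj_fiber_le.
Qed.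

Hypothesis hk : ball_word S n (k * g * k^-1)%g.

Lemma conj_ball c : c \in D -> ball_word S (3 * n) (x c).
Proof.
rewrite in_ball => /set_mem[_ cB].
rewrite (_ : (3 * n = (n + n) + n)%N); last by lia.
by apply: ball_wordM; [exact: ball_wordM|exact: ball_wordV].
Qed.

Lemma conj_sum_supp : [set z | conj_sum z <> 0] `<=` ball_word S (3 * n).
Proof.
move=> z /= nz; apply: contrapT => zB; apply: nz.
rewrite /conj_sum big_seq big1// => c cD.
have xB := conj_ball cD.
have xz : x c == z = false by apply/eqP => e; apply: zB; rewrite -e.
have xz' : (x c)^-1%g == z = false.
  by apply/eqP => e; apply: zB; rewrite -e; exact: ball_wordV.
by rewrite xz xz' addr0.
Qed.

Let A := fset_set (ball_word S (3 * n)).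

Let A_supp : [set z | conj_sum z <> 0] `<=` [set` A].
Proof.
move=> z /conj_sum_supp zB.
by rewrite /= in_fset_set ?inE//; exact: finite_ball_word.
Qed.

Lemma sum_conj_sum (H : set G) : (forall z, H z -> H z^-1%g) ->
  \sum_(z <- A | z \in H) conj_sum z = 2 * (count (fun c => x c \in H) D)%:R.
Proof.
move=> HV; rewrite /conj_sum exchange_big /= -sumr_pred_count mulr_sumr.
rewrite [LHS]big_seq [RHS]big_seq; apply: eq_bigr => c cD.
have E y : ball_word S (3 * n) y ->
    \sum_(z <- A | z \in H) (y == z)%:R = (y \in H)%:R :> R.
  move=> yB; rewrite big_mkcond (big_fsetD1 y) /=; last first.
    by rewrite in_fset_set ?inE//; exact: finite_ball_word.
  rewrite eqxx big1_seq ?addr0; first by case: ifP.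
  move=> z /andP[_]; rewrite !inE eq_sym => /andP[/negbTE -> _].
  by rewrite if_same.
have xB := conj_ball cD.
rewrite big_split /= (E _ xB) (E _ (ball_wordV hS xB)).
have -> : ((x c)^-1%g \in H) = (x c \in H).
  apply/idP/idP; rewrite !inE; last exact: HV.
  by move=> /HV; rewrite invgK.
by lra.
Qed.

(** The sum of [conj_sum] over [H] is twice the count, and the square of its
    l^2-norm is at most its upper bound [2b] times its l^1-norm [2a], where [a]
    and [b] are the two growths on the right. *)
Lemma count_conj_amenable_le (H : set G) :
  amenable R H -> (forall z, H z -> H z^-1%g) ->
  (count (fun c => x c \in H) D)%:R ^+ 2 <=
  rho R S (3 * n) ^+ 2 *
    ((growth S C n)%:R * (growth S (C `&` conj_set k C) (2 * n))%:R).
Proof.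
move=> amH HV; set b := growth S (_ `&` _) _.
pose f z := real_complex R (conj_sum z).
have fB : [set z | f z <> 0] `<=` ball_word S (3 * n).
  move=> z fz; apply: conj_sum_supp => /= z0; apply: fz.
  by rewrite /f z0 rmorph0.
have fA : [set z | f z <> 0] `<=` [set` A].
  by move=> z fz; apply: A_supp => /= z0; apply: fz; rewrite /f z0 rmorph0.
have h1 := amenable_sum_le_opnorm amH HV conj_sum_ge0 conj_sumV A_supp.
have h2 : 2 * (count (fun c => x c \in H) D)%:R <= rho R S (3 * n) * norm2 f.
  by rewrite -sum_conj_sum//; apply: (le_trans h1); exact: opnorm_lambda_le_rho.
have h3 : norm2 f ^+ 2 <= 4 * ((growth S C n)%:R * b%:R).
  rewrite -lee_fin -sqnorm2E; last by rewrite /ell2 /= (sqnorm2_fset fA) ltry.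
  rewrite (sqnorm2_fset fA) lee_fin.
  apply: (@le_trans _ _ (\sum_(y <- A) conj_sum y * (2 * b%:R))).
    apply: ler_sum => y _; rewrite normc_real ger0_norm ?conj_sum_ge0//.
    by rewrite expr2 ler_wpM2l ?conj_sum_ge0 ?conj_sum_le.
  have := @sum_conj_sum setT (fun _ _ => I).
  rewrite (eq_bigl xpredT); last by move=> z; rewrite in_setT.
  rewrite -mulr_suml => ->; rewrite (@eq_count _ _ xpredT); last first.
    by move=> z; rewrite in_setT.
  rewrite count_predT le_eqVlt; apply/orP; left; apply/eqP.
  by rewrite /growth -/C -/D; ring.
have h4 : (2 * (count (fun c => x c \in H) D)%:R) ^+ 2 <=
    (rho R S (3 * n) * norm2 f) ^+ 2.
  have N0 : 0 <= 2 * (count (fun c => x c \in H) D)%:R :> R by rewrite mulr_ge0.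
  by rewrite ler_pXn2r// nnegrE (le_trans N0).
have h5 := ler_wpM2l (sqr_ge0 (rho R S (3 * n))) h3.
move: h4; rewrite !exprMn => h4; have := le_trans h4 h5.
by lra.
Qed.
End counting.

(** * Fixed points of conjugates on a minimal space *)

Lemma near_forall_seq (T : eqType) (I : Type) (F : set_system I) (s : seq T)
    (P : T -> I -> Prop) : Filter F ->
  (forall k, k \in s -> \forall n \near F, P k n) ->
  \forall n \near F, forall k, k \in s -> P k n.
Proof.
move=> FF; elim: s => [|k s IH] hs; first by apply: nearW.
have h1 := hs k (mem_head _ _).
have h2 : \forall n \near F, forall j, j \in s -> P j n.
  by apply: IH => j js; apply: hs; rewrite inE js orbT.
apply: filterS2 h1 h2 => n Pk Ps j.
by rewrite inE => /orP[/eqP ->|/Ps].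
Qed.

Section action.
Variables (G : groupType) (X : topologicalType) (act : G -> X -> X).
Hypothesis hact : action_by_homeo act.

Let actK g : cancel (act g) (act g^-1%g).
Proof. by have [a1 aM _] := hact; move=> x; rewrite -aM mulVg a1. Qed.

Let actVK g : cancel (act g^-1%g) (act g).
Proof. by have [a1 aM _] := hact; move=> x; rewrite -aM mulgV a1. Qed.

Lemma open_act_preimage g (U : set X) : open U -> open (act g @^-1` U).
Proof.
by have [_ _ ac] := hact => oU; apply: open_comp => // x _; exact: ac.
Qed.

Lemma nbhs_stabilizerV x h :
  nbhs_stabilizer act x h -> nbhs_stabilizer act x h^-1%g.
Proof. by move=> [U Ux hU]; exists U => // y /hU hy; rewrite -{1}hy actK. Qed.

Lemma interior_fixed_conj g k x :
  interior (fixed_points act g) (act k^-1%g x) ->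
  interior (fixed_points act (k * g * k^-1)%g) x.
Proof.
have [_ aM _] := hact => hx.
have oV : open (act k^-1%g @^-1` interior (fixed_points act g)).
  by apply: open_act_preimage; exact: open_interior.
move: x hx; rewrite -/(_ `<=` _) -open_subsetE// => y /interior_subset.
by rewrite /fixed_points /= => gy; rewrite !aM gy actVK.
Qed.

Lemma interior_fixed_nbhs_stabilizer g x :
  interior (fixed_points act g) x -> nbhs_stabilizer act x g.
Proof.
move=> Ux; exists (interior (fixed_points act g)).
  by split => //; exact: open_interior.
by move=> y /interior_subset.
Qed.

Lemma interior_fixed_centralizer g c x : centralizer g c ->
  interior (fixed_points act g) (act c^-1%g x) ->
  interior (fixed_points act g) x.
Proof.
move=> cg /interior_fixed_conj.
by rewrite /centralizer /= /commute in cg; rewrite -cg mulgK.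
Qed.

(** Every orbit meets [U] by minimality, so the translates of [U] cover the
    compact space. *)
Lemma minimal_finite_cover (U : set X) : compact [set: X] ->
  minimal_action act -> open U -> U !=set0 ->
  exists D : seq G, forall x, exists2 k, k \in D & U (act k^-1%g x).
Proof.
move=> cX hmin oU [z Uz].
pose Xp : ptopologicalType := HB.pack X (isPointed.Build X z).
have : @cover_compact Xp setT by rewrite -compact_cover.
move=> /(_ G setT (fun k => act k^-1%g @^-1` U)) [].
- by move=> k _; exact: open_act_preimage.
- move=> x _; have [y [Uy [k _ ky]]] := hmin x U (ex_intro _ z Uz) oU.
  by exists k^-1%g => //=; rewrite invgK ky.
- move=> D _ DX; exists D => x; have [k /= kD Uk] := DX x I.
  by exists k.
Qed.
End action.

Theorem theorem1 (R : realType) (G : groupType) (S : {fset G})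
    (hS : symmetric_generating S)
    (g : G) (hg : ~ (forall h : G, commute g h))
    (hlim : forall c : G, ~ centralizer g c ->
      (fun n : nat =>
         rho R S (3 * n) ^+ 2
         * (growth S (centralizer g `&` conj_set c (centralizer g)) (2 * n))%:R
         / (growth S (centralizer g) n)%:R : R) @ \oo --> (0 : R))
    (X : topologicalType) (act : G -> X -> X)
    (hX : compact_space act)
    (hmin : minimal_action act)
    (hstab : forall x : X, amenable R (nbhs_stabilizer act x)) :
  acts_topologically_freely act g.
Proof.
have [cX _ hact] := hX; have [_ aM _] := hact.
pose U : set X := interior (fixed_points act g).
rewrite /acts_topologically_freely -/U; apply: contrapT => /eqP/set0P Un0.
pose ball n := fset_set (centralizer g `&` ball_word S n).
pose N k n x := count (fun c => act (c * k)^-1%g x \in U) (ball n).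
have a_gt0 n : 0 < (growth S (centralizer g) n)%:R :> R.
  rewrite ltr0n /growth cardfs_gt0; apply/fset0Pn; exists 1%g.
  by rewrite in_ball inE; split; [exact: commute1|exact: ball_word1].
(* Uniformly in [x], few [c] satisfy [x \in c k U]. *)
have small k (e : R) : ~ centralizer g k -> 0 < e ->
    \forall n \near \oo, forall x,
      (N k n x)%:R <= e * (growth S (centralizer g) n)%:R.
  move=> Ck e0; have [l lk] := hS.2 (k * g * k^-1)%g.
  have := hlim k Ck => /cvgr0_norm_lt /(_ (e ^+ 2)).
  rewrite exprn_gt0// => /(_ isT) hn.
  have hl : \forall n \near \oo, (l <= n)%N by exists l.
  apply: filterS2 hn hl => n hn ln x.
  have kB : ball_word S n (k * g * k^-1)%g by exact: ball_word_le lk.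
  have h1 :=
    count_conj_amenable_le hS kB (hstab x) (@nbhs_stabilizerV _ _ _ hact x).
  have h2 : (N k n x)%:R <= (count (fun c => (c * (k * g * k^-1) * c^-1)%g \in
      nbhs_stabilizer act x) (ball n))%:R :> R.
    rewrite ler_nat; apply: sub_count => c /set_mem Uc; apply/mem_set.
    apply: interior_fixed_nbhs_stabilizer.
    have := interior_fixed_conj hact Uc.
    by rewrite invgM !mulgA.
  rewrite -(@ler_pXn2r _ 2)// ?nnegrE ?mulr_ge0 ?ler0n ?(ltW e0)//.
  apply: (@le_trans _ _ ((count (fun c => (c * (k * g * k^-1) * c^-1)%g \in
      nbhs_stabilizer act x) (ball n))%:R ^+ 2)).
    by rewrite ler_pXn2r// ?nnegrE ?ler0n.
  apply: (le_trans h1); move: (ltW (le_lt_trans (ler_norm _) hn)).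
  rewrite ler_pdivrMr// => /(ler_wpM2r (ltW (a_gt0 n))); lra.
(* For each [c] in [C], the point [x] is in [c k U] for some [k] in [D];
   if [x] is not in [U], this [k] is outside [C]. *)
have UT x : U x.
  apply: contrapT => Ux.
  have [D DX] := minimal_finite_cover hact cX hmin (open_interior _) Un0.
  pose E := [seq k <- D | k \notin centralizer g].
  have e0 : 0 < ((size E).+1%:R)^-1 :> R by rewrite invr_gt0.
  have : \forall n \near \oo, forall k, k \in E -> forall x,
      (N k n x)%:R <=
        ((size E).+1%:R)^-1 * (growth S (centralizer g) n)%:R :> R.
    apply: near_forall_seq => k; rewrite mem_filter => /andP[kC _].
    by apply: small => // Ck; move: kC; rewrite mem_set.
  case=> n _ /(_ n (leqnn n)) hn.
  have : (growth S (centralizer g) n)%:R <= \sum_(k <- E) (N k n x)%:R :> R.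
    rewrite -natr_sum ler_nat /N.
    under eq_bigr do rewrite -sum1_count big_mkcond /=.
    rewrite exchange_big /= /growth -sum1_size big_seq [leqRHS]big_seq.
    apply: leq_sum => c; rewrite in_ball => /set_mem[Cc _].
    have [k kD Uk] := DX (act c^-1%g x).
    have Uck : U (act (c * k)^-1%g x) by rewrite invgM aM.
    have kE : k \in E.
      rewrite mem_filter kD andbT; apply/negP => /set_mem Ck; apply: Ux.
      exact: (interior_fixed_centralizer hact (commuteM Cc Ck) Uck).
    rewrite (big_rem k)//= mem_set//.
  apply/negP; rewrite -ltNge.
  apply: (@le_lt_trans _ _ (\sum_(k <- E)
      ((size E).+1%:R)^-1 * (growth S (centralizer g) n)%:R)).
    by rewrite big_seq [leRHS]big_seq; apply: ler_sum => k kE; exact: hn.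
  rewrite big_const_seq count_predT iter_addr_0 -[ltLHS]mulr_natl mulrA.
  rewrite gtr_pMl//.
  by rewrite ltr_pdivrMr// mul1r ltr_nat.
have [k Ck] : exists k, ~ centralizer g k by apply/existsNP.
have [z _] := Un0.
have half0 : 0 < 1 / 2 :> R by lra.
have [n _ /(_ n (leqnn n)) /(_ z)] := small k (1 / 2) Ck half0.
rewrite /N (@eq_count _ _ xpredT); last by move=> c; rewrite mem_set.
by rewrite count_predT; have := a_gt0 n; rewrite /growth -/(ball n); lra.
Qed.
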